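(* ${\bf ITL}^{\bf CD}$ and ${\bf ITL}^{\bf CD}_\Box$ are sound for the class of dynamic posets.
   Context: Formulas of $\mathcal L$ are built from propositional variables and $\bot$ by $\wedge,\vee,\to,\circ,\Diamond,\Box$; $\mathcal L_\Box$ is the $\Diamond$-free fragment. ${\bf ITL}^0$ is the logic axiomatized by all intuitionistic tautologies, $\neg\circ\bot$, $\circ(\varphi\wedge\psi)\leftrightarrow(\circ\varphi\wedge\circ\psi)$, $\circ(\varphi\vee\psi)\leftrightarrow(\circ\varphi\vee\circ\psi)$, $\circ(\varphi\to\psi)\to(\circ\varphi\to\circ\psi)$, $\Box(\varphi\to\psi)\to(\Box\varphi\to\Box\psi)$, $\Box(\varphi\to\psi)\to(\Diamond\varphi\to\Diamond\psi)$, $\Diamond(\varphi\vee\psi)\to(\Diamond\varphi\vee\Diamond\psi)$, $\Box\varphi\to\varphi\wedge\circ\Box\varphi$, $\varphi\vee\circ\Diamond\varphi\to\Diamond\varphi$, with rules: from $\varphi\to\circ\varphi$ infer $\varphi\to\Box\varphi$; from $\circ\varphi\to\varphi$ infer $\Diamond\varphi\to\varphi$; modus ponens; from $\varphi$ infer $\circ\varphi$. ${\bf ITL}^{\bf CD}={\bf ITL}^0+{\rm CD}$ where ${\rm CD}(\varphi,\psi)$ is $\Box(\varphi\vee\psi)\to\Box\varphi\vee\Diamond\psi$. ${\bf ITL}^{\bf CD}_\Box$ is obtained by restricting all rules and axioms of ${\bf ITL}^{\bf CD}$ to $\mathcal L_\Box$ and adding the axiom ${\rm BI}(\varphi,\psi)$: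 $\Box(\varphi\vee\psi)\wedge\Box(\circ\psi\to\psi)\to\Box\varphi\vee\psi$. A dynamic poset is a dynamical system $(W,\mathcal T,S)$ whose topology is the up-set topology of a partial order $\preccurlyeq$ (open = upward closed) and $S$ is monotone. Formulas are interpreted by valuations $[\![\cdot]\!]$ into open sets: $[\![\bot]\!]=\varnothing$, $\cap$ for $\wedge$, $\cup$ for $\vee$, $[\![\varphi\to\psi]\!]=((W\setminus[\![\varphi]\!])\cup[\![\psi]\!])^\circ$, $[\![\circ\varphi]\!]=S^{-1}[\![\varphi]\!]$, $[\![\Diamond\varphi]\!]=\bigcup_{n\ge0}S^{-n}[\![\varphi]\!]$, $[\![\Box\varphi]\!]=\bigcup\{U\text{ open}:S[U]\subseteq U\subseteq[\![\varphi]\!]\}$. Soundness for a class means every derivable formula has $[\![\varphi]\!]$ equal to the whole space for every valuation on every structure in the class. *)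

(* Defs.v *)
From mathcomp Require Import all_boot.
From mathcomp Require Import boolp classical_sets filter topology_structure.

Set Implicit Arguments.
Unset Strict Implicit.
Unset Printing Implicit Defensive.

Local Open Scope classical_set_scope.

Inductive iformula : Type :=
| IVar of nat
| IBot
| IAnd of iformula & iformula
| IOr of iformula & iformula
| IImp of iformula & iformula.

(* Hilbert calculus for intuitionistic propositional logic. *)
Inductive intuitionistic_tautology : iformula -> Prop :=
| ipc_K a b : intuitionistic_tautology (IImp a (IImp b a))
| ipc_S a b c : intuitionistic_tautology
    (IImp (IImp a (IImp b c)) (IImp (IImp a b) (IImp a c)))
| ipc_andI a b : intuitionistic_tautology (IImp a (IImp b (IAnd a b)))
| ipc_andEl a b : intuitionistic_tautology (IImp (IAnd a b) a)
| ipc_andEr a b : intuitionistic_tautology (IImp (IAnd a b) b)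
| ipc_orIl a b : intuitionistic_tautology (IImp a (IOr a b))
| ipc_orIr a b : intuitionistic_tautology (IImp b (IOr a b))
| ipc_orE a b c : intuitionistic_tautology
    (IImp (IImp a c) (IImp (IImp b c) (IImp (IOr a b) c)))
| ipc_botE a : intuitionistic_tautology (IImp IBot a)
| ipc_mp a b : intuitionistic_tautology a ->
    intuitionistic_tautology (IImp a b) -> intuitionistic_tautology b.

Inductive formula : Type :=
| Var of nat
| Bot
| And of formula & formula
| Or of formula & formula
| Imp of formula & formula
| Next of formula
| Dia of formula
| Box of formula.

Declare Scope itl_scope.
Delimit Scope itl_scope with itl.
Bind Scope itl_scope with formula.
Notation "○ p" := (Next p) (at level 35, right associativity) : itl_scope.
Notation "◇ p" := (Dia p) (at level 35, right associativity) : itl_scope.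
Notation "□ p" := (Box p) (at level 35, right associativity) : itl_scope.
Notation "p ⊓ q" := (And p q) (at level 40, left associativity) : itl_scope.
Notation "p ⊔ q" := (Or p q) (at level 50, left associativity) : itl_scope.
Notation "p ⇒ q" := (Imp p q) (at level 55, right associativity) : itl_scope.
Notation "p ⇔ q" := (And (Imp p q) (Imp q p))
  (at level 56, no associativity) : itl_scope.
Notation "⊥" := Bot : itl_scope.
Notation "¬ p" := (Imp p Bot) (at level 35, right associativity) : itl_scope.

Fixpoint isubst (s : nat -> formula) (a : iformula) : formula :=
  match a with
  | IVar n => s n
  | IBot => Bot
  | IAnd a b => And (isubst s a) (isubst s b)
  | IOr a b => Or (isubst s a) (isubst s b)
  | IImp a b => Imp (isubst s a) (isubst s b)
  end.

Fixpoint diamond_free (p : formula) : bool :=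
  match p with
  | Var _ | Bot => true
  | And p q | Or p q | Imp p q => diamond_free p && diamond_free q
  | Next p | Box p => diamond_free p
  | Dia _ => false
  end.

Inductive ITL0_axiom : formula -> Prop :=
| ax_taut a s : intuitionistic_tautology a -> ITL0_axiom (isubst s a)
| ax_next_bot : ITL0_axiom (¬ ○ ⊥)
| ax_next_and p q : ITL0_axiom (○ (p ⊓ q) ⇔ (○ p ⊓ ○ q))
| ax_next_or p q : ITL0_axiom (○ (p ⊔ q) ⇔ (○ p ⊔ ○ q))
| ax_next_imp p q : ITL0_axiom (○ (p ⇒ q) ⇒ (○ p ⇒ ○ q))
| ax_box_imp p q : ITL0_axiom (□ (p ⇒ q) ⇒ (□ p ⇒ □ q))
| ax_box_dia p q : ITL0_axiom (□ (p ⇒ q) ⇒ (◇ p ⇒ ◇ q))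
| ax_dia_or p q : ITL0_axiom (◇ (p ⊔ q) ⇒ (◇ p ⊔ ◇ q))
| ax_box_fix p : ITL0_axiom (□ p ⇒ (p ⊓ ○ □ p))
| ax_dia_fix p : ITL0_axiom ((p ⊔ ○ ◇ p) ⇒ ◇ p).

Definition CD (p q : formula) : formula := (□ (p ⊔ q) ⇒ (□ p ⊔ ◇ q))%itl.

Definition BI (p q : formula) : formula :=
  ((□ (p ⊔ q) ⊓ □ (○ q ⇒ q)) ⇒ (□ p ⊔ q))%itl.

(* Derivability from the axioms Ax with the rules of ITL^0, where every
   formula occurring in a derivation must belong to the language L. *)
Inductive derivable (L Ax : formula -> Prop) : formula -> Prop :=
| der_ax p : L p -> Ax p -> derivable L Ax p
| der_mp p q : L q ->
    derivable L Ax p -> derivable L Ax (p ⇒ q) -> derivable L Ax q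
| der_next p : L (○ p)%itl -> derivable L Ax p -> derivable L Ax (○ p)
| der_box p : L (p ⇒ □ p)%itl ->
    derivable L Ax (p ⇒ ○ p) -> derivable L Ax (p ⇒ □ p)
| der_dia p : L (◇ p ⇒ p)%itl ->
    derivable L Ax (○ p ⇒ p) -> derivable L Ax (◇ p ⇒ p).

Definition ITL_CD_axiom (p : formula) : Prop :=
  ITL0_axiom p \/ exists q r, p = CD q r.

Definition ITL_CD : formula -> Prop := derivable (fun=> True) ITL_CD_axiom.

Definition ITL_CD_Box : formula -> Prop :=
  derivable diamond_free (fun p => ITL_CD_axiom p \/ exists q r, p = BI q r).

Record dynamical_system := DynamicalSystem {
  space :> topologicalType;
  dmap : space -> space;
  dmap_continuous : continuous dmap }.

Definition upward_closed (W : Type) (le : rel W) (U : set W) : Prop :=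
  forall x y, U x -> le x y -> U y.

Definition dynamic_poset (X : dynamical_system) : Prop :=
  exists le : rel X,
    [/\ reflexive le, antisymmetric le, transitive le,
        forall U : set X, open U <-> upward_closed le U
      & {homo @dmap X : x y / le x y}].

Fixpoint interp (X : dynamical_system) (v : nat -> set X) (p : formula)
    : set X :=
  match p with
  | Var n => v n
  | Bot => set0
  | And p q => interp v p `&` interp v q
  | Or p q => interp v p `|` interp v q
  | Imp p q => interior (~` interp v p `|` interp v q)
  | Next p => @dmap X @^-1` interp v p
  | Dia p => \bigcup_n (iter n (@dmap X) @^-1` interp v p)
  | Box p => \bigcup_(U in [set U : set X |
      [/\ open U, @dmap X @` U `<=` U & U `<=` interp v p]]) U
  end.

Definition valid (X : dynamical_system) (p : formula) : Prop :=
  forall v : nat -> set X, (forall n, open (v n)) -> interp v p = setT.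

Definition sound (Lambda : formula -> Prop) (C : dynamical_system -> Prop)
    : Prop :=
  forall p, Lambda p -> forall X, C X -> valid X p.

(* Main.v *)
(** On a dynamic poset the orbit condition [forall n, S^n x \in U] defines an
    up-set when [U] is one, because [S] is monotone; hence [Box] is true
    intersection over the orbit, dual to [Dia], and the semantics is Kripke
    semantics.  CD and BI then hold by excluded middle on the orbit: either
    [p] holds at every [S^n x], or some [S^n x] satisfies [q]; in the case of
    BI, [q] is then carried back along the orbit from [S^n x] to [x]. *)
From mathcomp Require Import all_boot.
From mathcomp Require Import boolp classical_sets filter topology_structure.
Require Import Defs.

Set Implicit Arguments.
Unset Strict Implicit.
Unset Printing Implicit Defensive.

Local Open Scope classical_set_scope.

Section DynamicPosetSemantics.

Variables (X : dynamical_system) (le : rel X).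
Hypothesis le_refl : reflexive le.
Hypothesis le_trans : transitive le.
Hypothesis openE : forall U : set X, open U <-> upward_closed le U.
Hypothesis dmap_homo : {homo @dmap X : x y / le x y}.
Variable v : nat -> set X.
Hypothesis v_open : forall n, open (v n).

Local Notation S := (@dmap X).
Local Notation "x ⊩ p" := (interp v p x) (at level 60).

Lemma iter_dmap_homo n : {homo iter n S : x y / le x y}.
Proof. by elim: n => [//|n IHn] x y xy; apply/dmap_homo/IHn. Qed.

(** The principal up-set of [x] is its least open neighbourhood, by transitivity and reflexivity of
    [le]. *)
Lemma interior_upE (A : set X) x :
  interior A x <-> forall y, le x y -> A y.
Proof.
split=> [Ax y xy | Aup].
  exact: interior_subset ((openE _).1 (open_interior A) _ _ Ax xy).
rewrite /interior nbhsE; exists (fun y => le x y) => //.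
by split=> //; apply/openE => y z /= xy; exact: le_trans.
Qed.

Lemma interp_impE p q x :
  x ⊩ Imp p q <-> forall y, le x y -> y ⊩ p -> y ⊩ q.
Proof.
rewrite /= interior_upE; split=> [H y xy py | H y xy].
  by have [|] := H y xy.
by have [py|] := pselect (y ⊩ p); [right; exact: H | left].
Qed.

Lemma interp_diaE p x : x ⊩ Dia p <-> exists n, iter n S x ⊩ p.
Proof. by split=> [[n _ ?] | [n ?]]; exists n. Qed.

(** Persistence: truth passes to larger points. For [Next] and [Dia] this rests on the monotonicity
    of [S] and its iterates. *)
Lemma interp_up p : upward_closed le (interp v p).
Proof.
elim: p => [n||p IHp q IHq|p IHp q IHq|p IHp q IHq|p IHp|p IHp|p IHp] x y.
- exact: (openE _).1 (v_open n) x y.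
- by [].
- by move=> [px qx] xy; split; [exact: IHp xy | exact: IHq xy].
- by move=> [px|qx] xy; [left; exact: IHp xy | right; exact: IHq xy].
- move=> /interp_impE H xy; apply/interp_impE => z yz.
  exact/H/(le_trans xy yz).
- by move=> /= px xy; exact: IHp px (dmap_homo xy).
- move=> /interp_diaE[n px] xy; apply/interp_diaE; exists n.
  exact: IHp px (iter_dmap_homo n xy).
(* The open set witnessing [Box p] at [x] is an up-set, so it contains [y] as well. *)
- by move=> [U [oU SU Up] Ux] xy; exists U => //; exact: (openE U).1 oU x y Ux xy.
Qed.

Lemma interp_boxE p x : x ⊩ Box p <-> forall n, iter n S x ⊩ p.
Proof.
split=> [[U [_ SU Up] Ux] n | H].
  by apply: Up; elim: n => [//|n IHn]; apply: SU; exists (iter n S x).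
(* The candidate is the set of all points whose whole orbit satisfies [p]; it is open by persistence
   along monotone iterates. *)
exists [set y | forall n, iter n S y ⊩ p] => //; split.
- apply/openE => y z /= yp yz n.
  exact: interp_up (yp n) (iter_dmap_homo n yz).
- by move=> _ [y yp <-] n; rewrite -iterSr; exact: (yp n.+1).
- by move=> y /(_ 0).
Qed.

Definition holds p := forall x, x ⊩ p.

(** When all points are considered, reflexivity lets the quantifier over successors collapse. *)
Lemma holds_imp p q : holds (Imp p q) <-> forall x, x ⊩ p -> x ⊩ q.
Proof.
split=> [H x | H x]; first by move/interp_impE: (H x); exact.
by apply/interp_impE => y _; exact: H.
Qed.

Lemma tautology_holds a s : intuitionistic_tautology a -> holds (isubst s a).
Proof.
elim=> {a} [a b|a b c|a b|a b|a b|a b|a b|a b c|a|a b _ IHa _ IHab] //=;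
  try apply/holds_imp => x.
(* Persistence carries the first premise to the later point, here and for conjunction
   introduction. *)
- by move=> ax; apply/interp_impE => y xy _; exact: interp_up ax xy.
- move=> /interp_impE abc; apply/interp_impE => y xy /interp_impE ab.
  apply/interp_impE => z yz az.
  have /interp_impE := abc z (le_trans xy yz) az.
  by apply=> //; exact: ab.
- move=> ax; apply/interp_impE => y xy bz.
  by split=> //; exact: interp_up ax xy.
- by case.
- by case.
- by left.
- by right.
- move=> /interp_impE ac; apply/interp_impE => y xy /interp_impE bc.
  apply/interp_impE => z yz [az|bz]; last exact: bc.
  exact: ac (le_trans xy yz) az.
- by [].
- by move: IHab => /holds_imp ab x; exact/ab/IHa.
Qed.

Lemma ITL0_axiom_holds p : ITL0_axiom p -> holds p.
Proof.
case=> {p} [a s|||||||||]; first exact: tautology_holds.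
- exact/holds_imp.
- by move=> p q x; split; apply/holds_imp: x.
- by move=> p q x; split; apply/holds_imp: x.
- move=> p q; apply/holds_imp => x /interp_impE pq.
  apply/interp_impE => y xy py; exact: pq (dmap_homo xy) py.
- move=> p q; apply/holds_imp => x /interp_boxE pq.
  apply/interp_impE => y xy /interp_boxE py; apply/interp_boxE => n.
  (* The implication at the [n]-th iterate of [x] applies at that of [y], which lies above it. *)
  by have /interp_impE := pq n; apply; [exact: iter_dmap_homo | exact: py].
- move=> p q; apply/holds_imp => x /interp_boxE pq.
  apply/interp_impE => y xy /interp_diaE[n py]; apply/interp_diaE; exists n.
  by have /interp_impE := pq n; apply; [exact: iter_dmap_homo | exact: py].
- move=> p q; apply/holds_imp => x /interp_diaE[n [pn|qn]]; [left|right];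
    by apply/interp_diaE; exists n.
- move=> p; apply/holds_imp => x /interp_boxE px; split; first exact: (px 0).
  by apply/interp_boxE => n; rewrite -iterSr; exact: (px n.+1).
- move=> p; apply/holds_imp => x [px|/interp_diaE[n pn]]; apply/interp_diaE.
    by exists 0.
  by exists n.+1; rewrite iterSr.
Qed.

(** Common core of CD and BI. The time [n] is kept explicit so that BI can induct on it. *)
Lemma orbit_or p q x : x ⊩ Box (Or p q) ->
  x ⊩ Box p \/ exists n, iter n S x ⊩ q.
Proof.
move=> /interp_boxE pq.
have [?|nq] := pselect (exists n, iter n S x ⊩ q); [by right|left].
apply/interp_boxE => n; have [//|qn] := pq n.
by case: nq; exists n.
Qed.

Lemma CD_holds p q : holds (CD p q).
Proof.
apply/holds_imp => x /orbit_or[|/interp_diaE]; by [left|right].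
Qed.

Lemma BI_holds p q : holds (BI p q).
Proof.
apply/holds_imp => x [/orbit_or[|[n qn]] back]; [by left|right].
elim: n qn => [//|n IHn] qn; apply: IHn.
(* [q] at time [n.+1] is [Next q] at time [n], so the boxed implication gives [q] one step
   earlier. *)
have /interp_impE := (interp_boxE (Imp (Next q) q) x).1 back n; exact.
Qed.

(** The rules preserve truth at all points under the fixed valuation. The two induction rules become
    induction on [n]: one pushes [p] forward along the orbit, the other pulls it back to the
    start. *)
Lemma derivable_holds (L Ax : formula -> Prop) :
  (forall p, Ax p -> holds p) -> forall p, derivable L Ax p -> holds p.
Proof.
move=> Axh p; elim=> {p} [p _ /Axh //|p q _ _ hp _ /holds_imp pq x||p _ _|p _ _].
- exact/pq/hp.
- by move=> p _ _ hp x; exact: hp.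
- move=> /holds_imp pS; apply/holds_imp => x px; apply/interp_boxE.
  by elim=> [//|n IHn]; exact: pS IHn.
- move=> /holds_imp Sp; apply/holds_imp => x /interp_diaE[n].
  by elim: n => [//|n IHn] pn; apply/IHn/Sp.
Qed.

End DynamicPosetSemantics.

(** Generic in [L] and [Ax] so that both logics are instances. *)
Lemma derivable_sound (L Ax : formula -> Prop) :
  (forall p, Ax p -> ITL_CD_axiom p \/ exists q r, p = BI q r) ->
  sound (derivable L Ax) dynamic_poset.
Proof.
move=> AxP p Lp X [le [le_refl _ le_trans openE dmap_homo]] v v_open.
apply/seteqP; split=> // x _.
apply: (derivable_holds le_refl le_trans openE dmap_homo v_open _ Lp).
move=> q /AxP[[q0|[r [s ->]]]|[r [s ->]]].
- exact: (ITL0_axiom_holds le_refl le_trans openE dmap_homo v_open q0).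
- exact: (CD_holds le_refl le_trans openE dmap_homo v_open r s).
- exact: (BI_holds le_refl le_trans openE dmap_homo v_open r s).
Qed.

Theorem theorem5p3 : sound ITL_CD dynamic_poset /\ sound ITL_CD_Box dynamic_poset.
Proof.
by split; apply: derivable_sound => p; [left|].
Qed.
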